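(* Let $T$ be an $n\times n$ real symmetric tridiagonal matrix with diagonal elements $\alpha_1,\ldots,\alpha_n$ and off-diagonal elements $\beta_2,\ldots,\beta_n$, and assume the floating point assumptions stated in the context. If $$\hat{c}_2^{(2)} = \mathrm{fl}\Big[\mathrm{fl}\left[\alpha_1\alpha_2\right]-\mathrm{fl}\left[\beta_2^2\right]\Big],$$ $$\hat c_2^{(i)} = \mathrm{fl}\Big[\mathrm{fl}\left[\hat c_2^{(i-1)}-\mathrm{fl}\left[\alpha_i\hat c_1^{(i-1)}\right]\right]-\mathrm{fl}\left[\beta_i^2\right]\Big],\qquad 3\leq i\leq n,$$ then $$|e_2^{(2)}| \leq u\left(|\alpha_2\alpha_1|+|\beta_2^2|+|\hat c_2^{(2)}|\right)$$ and, for $3\le i\le n$, $$|e_2^{(i)}|\leq |e_2^{(i-1)}|+|\alpha_ie_1^{(i-1)}|+u\left(|\hat c_2^{(i-1)}|+|\beta_i^2|+|\hat c_2^{(i)}|\right)+\gamma_2\,|\alpha_i\hat{c}_1^{(i-1)}|.$$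
   Context: $\beta_i$ is in positions $(i-1,i)$ and $(i,i-1)$ of $T$. $T_i$ is the leading principal submatrix of $T$ of order $i$, and $\det(\lambda I-T_i)=\lambda^i+c_1^{(i)}\lambda^{i-1}+\cdots+c_{i-1}^{(i)}\lambda+c_i^{(i)}$, $1\le i\le n$. Thus $c_1^{(1)}=-\alpha_1$, $c_1^{(i)}=c_1^{(i-1)}-\alpha_i$ for $i\ge2$, $c_2^{(2)}=\alpha_1\alpha_2-\beta_2^2$, and $c_2^{(i)}=c_2^{(i-1)}-\alpha_ic_1^{(i-1)}-\beta_i^2$ for $i\ge 3$. Floating point assumptions: all matrix elements are normalized real floating point numbers; $u$ is the unit roundoff and $nu<1$; no operation underflows or overflows; $\mathrm{fl}[\cdot]$ denotes the result computed in floating point arithmetic. For $\mathrm{op}\in\{+,-,\times,/\}$ and normalized real floating point numbers $x,y$ such that $x\ \mathrm{op}\ y$ does not underflow or overflow, $\mathrm{fl}[x\ \mathrm{op}\ y]=(x\ \mathrm{op}\ y)(1+\delta)$ for some $|\delta|\le u$, and also $\mathrm{fl}[x\ \mathrm{op}\ y]=(x\ \mathrm{op}\ y)/(1+\epsilon)$ for some $|\epsilon|\le u$. $\gamma_m=\frac{mu}{1-mu}$. $\hat c_j^{(i)}$ denotes the floating point computed value of $c_j^{(i)}$, with error $e_j^{(i)}=\hat c_j^{(i)}-c_j^{(i)}$. The values $\hat c_1^{(i)}$ are computed by $\hat c_1^{(1)}=c_1^{(1)}=-\alpha_1$ (exact, so $e_1^{(1)}=0$) and $\hat{c}_1^{(i)}=\mathrm{fl}[\hat{c}_1^{(i-1)}-\alpha_i]$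 for $2\le i\le n$. *)

(* Defs.v *)
From HB Require Import structures.
From mathcomp Require Import all_boot all_order all_algebra.
From mathcomp Require Import reals.

Set Implicit Arguments.
Unset Strict Implicit.
Unset Printing Implicit Defensive.

Import Order.TTheory GRing.Theory Num.Theory.
Local Open Scope ring_scope.

Inductive fp_op := FAdd | FSub | FMul | FDiv.

Definition exact_op (R : realType) (op : fp_op) (x y : R) : R :=
  match op with
  | FAdd => x + y
  | FSub => x - y
  | FMul => x * y
  | FDiv => x / y
  end.

(* The standard model of floating point arithmetic.  The set of floating point
   numbers, the rounding rule and the exponent range stay abstract: only the
   properties below are assumed, so every concrete format is an instance.
   [fp_num] is the set of normalized numbers, zero being counted among them
   (as the result of an exact cancellation); [fp_ok op x y] says that
   [x op y] neither underflows nor overflows; [fl op x y] is fl[x op y].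
   The side condition on [FDiv] is there because [x / 0 = 0] in MathComp. *)
Record fp_arith (R : realType) := FpArith {
  fp_num : R -> Prop;
  unit_roundoff : R;
  fp_ok : fp_op -> R -> R -> Prop;
  fl : fp_op -> R -> R -> R;
  unit_roundoff_ge0 : 0 <= unit_roundoff;
  fp_numN : forall x, fp_num x -> fp_num (- x);
  fl_num : forall op x y, fp_num x -> fp_num y ->
    (op = FDiv -> y != 0) -> fp_ok op x y -> fp_num (fl op x y);
  fl_mulE : forall op x y, fp_num x -> fp_num y ->
    (op = FDiv -> y != 0) -> fp_ok op x y ->
    exists2 delta : R, `|delta| <= unit_roundoff &
      fl op x y = exact_op op x y * (1 + delta);
  fl_divE : forall op x y, fp_num x -> fp_num y ->
    (op = FDiv -> y != 0) -> fp_ok op x y ->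
    exists2 eps : R, `|eps| <= unit_roundoff &
      fl op x y = exact_op op x y / (1 + eps)
}.

Definition gamma (R : realType) (u : R) (m : nat) : R :=
  m%:R * u / (1 - m%:R * u).

(* Diagonal alpha 1, ..., alpha n and off-diagonal beta 2, ..., beta n, with the
   usual numbering from 1; ordinals number rows and columns from 0, whence the
   shifts.  The other values of alpha and beta are irrelevant. *)
Definition sym_tridiag_mx (R : realType) (n : nat) (alpha beta : nat -> R) :
    'M[R]_n :=
  \matrix_(i < n, j < n)
    if i == j :> nat then alpha i.+1
    else if j == i.+1 :> nat then beta j.+1
    else if i == j.+1 :> nat then beta i.+1
    else 0.

(* An index of type ['I_n.+1] is an order between 0 and n. *)
Definition leading_submx (R : realType) (n : nat) (T : 'M[R]_n) (i : 'I_n.+1) :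
    'M[R]_i :=
  mxsub (widen_ord (leq_ord i)) (widen_ord (leq_ord i)) T.

(* The coefficient c_j^(i) of lambda^(i - j) in det(lambda I - T_i); meaningful
   for j <= i <= n only. *)
Definition char_coef (R : realType) (n : nat) (T : 'M[R]_n) (j i : nat) : R :=
  (char_poly (leading_submx T (inord i)))`_(i - j).

(* [chat] is the sequence of computed values of c_j^(1), ..., c_j^(n). *)
Definition coef_err (R : realType) (n : nat) (T : 'M[R]_n) (j : nat)
    (chat : nat -> R) (i : nat) : R :=
  chat i - char_coef T j i.

(* Main.v *)
(* Expanding det(lambda I - T_i) along its last row gives the three-term
   recurrence p_i = (X - alpha_i) p_(i-1) - beta_i^2 p_(i-2); as p_(i-2) is monic,
   c_2^(i) = c_2^(i-1) - alpha_i c_1^(i-1) - beta_i^2.  Subtract this from the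
   computed recurrence, using fl[x op y] = (x op y)(1 + delta) for the inner
   operations but fl[x op y](1 + eps) = x op y for the outermost subtraction:
   this is what makes the last rounding error proportional to the computed value.
   The product alpha_i c_1^(i-1) is rounded twice, by (1 + d1)(1 + d2), whence
   gamma_2. *)
Require Import Defs.
From HB Require Import structures.
From mathcomp Require Import all_boot all_order all_algebra.
From mathcomp Require Import reals.
From mathcomp Require Import zify ring lra.

Set Implicit Arguments.
Unset Strict Implicit.
Unset Printing Implicit Defensive.

Import Order.TTheory GRing.Theory Num.Theory.
Local Open Scope ring_scope.

(** Indexing [F] by [nat] makes all leading minors instances of one family. In the last row only
    columns [n] and [n.+1] can be nonzero; the first gives a minor that one further expansion, along
    its last column, reduces to order [n]. *)
Lemma det_tridiag_recr (R : comNzRingType) (F : nat -> nat -> R) (n : nat)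
    (hF : forall i j, (i.+1 < j)%N || (j.+1 < i)%N -> F i j = 0) :
  \det (\matrix_(i < n.+2, j < n.+2) F i j) =
    F n.+1 n.+1 * \det (\matrix_(i < n.+1, j < n.+1) F i j)
    - F n n.+1 * F n.+1 n * \det (\matrix_(i < n, j < n) F i j).
Proof.
rewrite (expand_det_row _ ord_max) 2!big_ord_recr /= big1 ?add0r; last first.
  by move=> i _; rewrite mxE hF ?mul0r //= !ltnS ltn_ord orbT.
rewrite !mxE /= addrC; congr (_ * _ + _).
  rewrite /cofactor -signr_odd oddD addbb mul1r; congr (\det _).
  by apply/matrixP => i j; rewrite !mxE !lift_max.
(* Positions [n.+1] and [n] have an odd sum, whence the minus sign of the second term. *)
rewrite /cofactor /= addSn exprS mulN1r -signr_odd oddD addbb /= mulN1r.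
(* With column [n] deleted, the last column of the minor is the original column [n.+1], whose only
   possibly nonzero entry above the deleted row is [F n n.+1]. *)
rewrite (expand_det_col _ ord_max) big_ord_recr /= big1 ?add0r; last first.
  move=> i _; rewrite !mxE hF ?mul0r //= /bump leqnn.
  by rewrite [(n < i)%N]ltnNge (ltnW (ltn_ord i)) !add0n add1n !ltnS ltn_ord.
rewrite !mxE /= /bump ltnn leqnn /= add0n add1n.
rewrite /cofactor -signr_odd oddD addbb mul1r mulrN mulrA (mulrC (F n.+1 n)).
congr (- (_ * \det _)).
apply/matrixP => i j; rewrite !mxE !lift_max /=.
by congr F; rewrite /bump; have /= := ltn_ord j; lia.
Qed.

Lemma char_poly_sym_tridiag_recr (R : realType) (n : nat)
    (alpha beta : nat -> R) :
  char_poly (sym_tridiag_mx n.+2 alpha beta) =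
    ('X - (alpha n.+2)%:P) * char_poly (sym_tridiag_mx n.+1 alpha beta)
    - (beta n.+2 ^+ 2)%:P * char_poly (sym_tridiag_mx n alpha beta).
Proof.
(* The entries of $XI-T$, independent of the order. Both off-diagonal entries are $-\beta$, so their
   product is $\beta^2$. *)
pose F i j : {poly R} := if i == j then 'X - (alpha i.+1)%:P
  else if j == i.+1 then - (beta j.+1)%:P
  else if i == j.+1 then - (beta i.+1)%:P else 0.
have charF m : char_poly (sym_tridiag_mx m alpha beta) =
    \det (\matrix_(i < m, j < m) F i j).
  congr (\det _); apply/matrixP => i j; rewrite !mxE /F -val_eqE.
  by case: (_ == _); rewrite ?mulr1n // sub0r;
    do 2?case: (_ == _); rewrite ?oppr0.
rewrite !charF det_tridiag_recr; last first.
  by move=> i j ij; rewrite /F !ifN //; lia.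
rewrite /F !eqxx (gtn_eqF (ltnSn n)) (ltn_eqF (ltnSn n)).
rewrite (ltn_eqF (leqnSn n.+1)).
by rewrite mulrNN -polyCM -expr2.
Qed.

Lemma leading_submx_sym_tridiag (R : realType) (n : nat) (alpha beta : nat -> R)
    (i : 'I_n.+1) :
  leading_submx (sym_tridiag_mx n alpha beta) i = sym_tridiag_mx i alpha beta.
Proof. by apply/matrixP => j k; rewrite !mxE. Qed.

Lemma char_coef_sym_tridiag (R : realType) (n : nat) (alpha beta : nat -> R)
    (j i : nat) :
  (i <= n)%N ->
  char_coef (sym_tridiag_mx n alpha beta) j i =
    (char_poly (sym_tridiag_mx i alpha beta))`_(i - j).
Proof. by move=> lein; rewrite /char_coef leading_submx_sym_tridiag inordK. Qed.

(** Order 2 cannot be covered by the recurrence: [char_coef T 2 1] reads coefficient [1 - 2 = 0] by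
    truncated subtraction, which is $c_1^{(1)}$ rather than 0. *)
Lemma char_coef2_order2 (R : realType) (n : nat) (alpha beta : nat -> R) :
  (2 <= n)%N ->
  char_coef (sym_tridiag_mx n alpha beta) 2 2 =
    alpha 1%N * alpha 2%N - beta 2%N ^+ 2.
Proof.
move=> n2; rewrite char_coef_sym_tridiag // char_poly_sym_tridiag_recr.
rewrite /char_poly det_mx00 det_mx11 !mxE /= mulr1n.
(* The constant coefficient is obtained by evaluating at 0. *)
by rewrite -horner_coef0 !hornerE; ring.
Qed.

Lemma char_coef2_recr (R : realType) (n : nat) (alpha beta : nat -> R)
    (i : nat) :
  (3 <= i <= n)%N ->
  let T := sym_tridiag_mx n alpha beta in
  char_coef T 2 i =
    char_coef T 2 i.-1 - alpha i * char_coef T 1 i.-1 - beta i ^+ 2.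
Proof.
case: i => [|[|[|i]]] // /andP[_ lein] T.
rewrite !char_coef_sym_tridiag //=; try by lia.
rewrite char_poly_sym_tridiag_recr !subSS !subn0.
set p1 := char_poly (sym_tridiag_mx i.+2 _ _).
set p0 := char_poly (sym_tridiag_mx i.+1 _ _).
(* The order is now [i.+3], so the coefficient sought has index [i.+1], which is exactly the degree
   of [p0]. *)
have p0_top : p0`_i.+1 = 1.
  have /monicP := char_poly_monic (sym_tridiag_mx i.+1 alpha beta).
  by rewrite lead_coefE size_char_poly.
by rewrite coefB mulrBl coefB coefXM !coefCM p0_top mulr1.
Qed.

(** The left side is at most $2u+u^2$, and $(2u+u^2)(1-2u)=2u-3u^2-2u^3\le 2u$. *)
Lemma gamma2_bound (R : realType) (u d1 d2 : R) :
  2%:R * u < 1 -> `|d1| <= u -> `|d2| <= u ->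
  `|(1 + d1) * (1 + d2) - 1| <= gamma u 2.
Proof.
move=> u2 d1u d2u.
have u0 : 0 <= u := le_trans (normr_ge0 _) d1u.
have -> : (1 + d1) * (1 + d2) - 1 = d1 + d2 + d1 * d2 by ring.
have : `|d1 * d2| <= u * u by rewrite normrM ler_pM.
have := ler_normD (d1 + d2) (d1 * d2); have := ler_normD d1 d2.
move=> h1 h2 h3; apply: (@le_trans _ _ (2%:R * u + u * u)); first by lra.
by rewrite /gamma ler_pdivlMr; nra.
Qed.

Theorem theorem4p3 (R : realType) (M : fp_arith R) (n : nat)
  (alpha beta : nat -> R) (T : 'M[R]_n) (chat1 chat2 : nat -> R)
  (hn : (2 <= n)%N)
  (hT : T = sym_tridiag_mx n alpha beta)
  (halpha : forall i : nat, (1 <= i <= n)%N -> fp_num M (alpha i))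
  (hbeta : forall i : nat, (2 <= i <= n)%N -> fp_num M (beta i))
  (hnu : n%:R * unit_roundoff M < 1)
  (hc1_1 : chat1 1%N = - alpha 1%N)
  (hc1 : forall i : nat, (2 <= i <= n)%N ->
     chat1 i = fl M FSub (chat1 i.-1) (alpha i))
  (hc1_ok : forall i : nat, (2 <= i <= n)%N ->
     fp_ok M FSub (chat1 i.-1) (alpha i))
  (hc2_2 : chat2 2%N =
     fl M FSub (fl M FMul (alpha 1%N) (alpha 2%N))
               (fl M FMul (beta 2%N) (beta 2%N)))
  (hc2_2_ok :
     [/\ fp_ok M FMul (alpha 1%N) (alpha 2%N),
         fp_ok M FMul (beta 2%N) (beta 2%N)
       & fp_ok M FSub (fl M FMul (alpha 1%N) (alpha 2%N))
                      (fl M FMul (beta 2%N) (beta 2%N))])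
  (hc2 : forall i : nat, (3 <= i <= n)%N ->
     chat2 i =
       fl M FSub
         (fl M FSub (chat2 i.-1) (fl M FMul (alpha i) (chat1 i.-1)))
         (fl M FMul (beta i) (beta i)))
  (hc2_ok : forall i : nat, (3 <= i <= n)%N ->
     [/\ fp_ok M FMul (alpha i) (chat1 i.-1),
         fp_ok M FSub (chat2 i.-1) (fl M FMul (alpha i) (chat1 i.-1)),
         fp_ok M FMul (beta i) (beta i)
       & fp_ok M FSub
           (fl M FSub (chat2 i.-1) (fl M FMul (alpha i) (chat1 i.-1)))
           (fl M FMul (beta i) (beta i))]) :
  let u := unit_roundoff M in
  let e1 := coef_err T 1 chat1 in
  let e2 := coef_err T 2 chat2 in
  `|e2 2%N| <= u * (`|alpha 2%N * alpha 1%N| + `|beta 2%N ^+ 2| + `|chat2 2%N|)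
  /\ forall i : nat, (3 <= i <= n)%N ->
       `|e2 i| <= `|e2 i.-1| + `|alpha i * e1 i.-1|
                  + u * (`|chat2 i.-1| + `|beta i ^+ 2| + `|chat2 i|)
                  + gamma u 2 * `|alpha i * chat1 i.-1|.
Proof.
move=> u e1 e2.
have u0 : 0 <= u := unit_roundoff_ge0 M.
have u2 : 2%:R * u < 1.
  by apply: le_lt_trans hnu; rewrite ler_wpM2r // ler_nat.
have sub_relerr x y : fp_num M x -> fp_num M y -> fp_ok M FSub x y ->
    exists2 d, `|d| <= u & x - y = fl M FSub x y * (1 + d).
  move=> xM yM ok; have [//|d] := fl_divE xM yM _ ok; rewrite -/u => du ->.
  exists d => //; rewrite divfK //.
  (* Since $2u<1$ and $|d|\le u$, $1+d>0$ and the division can be undone. *)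
  by have := ler_norm (- d); rewrite normrN => ?; apply: lt0r_neq0; lra.
(* The rounding model speaks only of operands in [fp_num], so every computed value must first be
   shown to lie there. *)
have chat1_num i : (1 <= i <= n)%N -> fp_num M (chat1 i).
  elim: i => [//|[|i] IH] in_; first by rewrite hc1_1; apply/fp_numN/halpha.
  rewrite hc1 //=; apply: fl_num => //; last exact: (hc1_ok i.+2).
    by apply: IH; lia.
  exact: halpha.
have beta_sq i : (2 <= i <= n)%N -> fp_ok M FMul (beta i) (beta i) ->
    fp_num M (fl M FMul (beta i) (beta i)).
  by move=> in_ ok; apply: fl_num => //; exact: hbeta.
have chat2_num i : (2 <= i <= n)%N -> fp_num M (chat2 i).
  elim: i => [//|[//|[_ _|i IH in_]]].
    have [? ? ?] := hc2_2_ok; rewrite hc2_2.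
    apply: fl_num => //; last exact: beta_sq.
    by apply: fl_num => //; apply: halpha; lia.
  have [? ? ? ?] := hc2_ok i.+3 in_; rewrite hc2 //.
  apply: fl_num => //; last by apply: beta_sq.
  apply: fl_num => //; first by apply: IH; lia.
  by apply: fl_num => //; [apply: halpha|apply: chat1_num]; lia.
have prod_bound x y d : `|d| <= y -> `|x * d| <= y * `|x|.
  by move=> dy; rewrite normrM mulrC ler_wpM2r.
split.
  have [ok1 ok2 ok3] := hc2_2_ok.
  have a1 : fp_num M (alpha 1%N) by apply: halpha; lia.
  have a2 : fp_num M (alpha 2%N) by apply: halpha; lia.
  have b2 : fp_num M (beta 2%N) by apply: hbeta; lia.
  have [||d3 d3u] := sub_relerr _ _ _ _ ok3; try exact: fl_num.
  rewrite -hc2_2.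
  have [//|d1 d1u ->] := fl_mulE a1 a2 _ ok1.
  have [//|d2 d2u ->] := fl_mulE b2 b2 _ ok2.
  move=> /= eq3.
  have -> : e2 2%N = alpha 2%N * alpha 1%N * d1 - beta 2%N ^+ 2 * d2
      - chat2 2%N * d3.
    by rewrite /e2 /coef_err hT char_coef2_order2 //; lra.
  rewrite !mulrDr.
  apply: le_trans (ler_normB _ _) _; apply: lerD; last exact: prod_bound.
  by apply: le_trans (ler_normB _ _) _; apply: lerD; exact: prod_bound.
move=> i in_; have [ok1 ok2 ok3 ok4] := hc2_ok i in_.
have i_n : (1 <= i <= n)%N by lia.
have i1_n : (1 <= i.-1 <= n)%N by lia.
have ai := halpha i i_n; have c1 := chat1_num _ i1_n.
have c2 : fp_num M (chat2 i.-1) by apply: chat2_num; lia.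
have bi : fp_num M (beta i) by apply: hbeta; lia.
have [||d4 d4u] := sub_relerr _ _ _ _ ok4; first by do 2?apply: fl_num.
  exact: fl_num.
rewrite -hc2 //.
have [|//|d2 d2u ->] := fl_mulE c2 _ _ ok2; first exact: fl_num.
have [//|d1 d1u ->] := fl_mulE ai c1 _ ok1.
have [//|d3 d3u ->] := fl_mulE bi bi _ ok3.
move=> /= eq4.
(* The inner subtraction error [d2] acts on both operands: it appears alone on [chat2 i.-1] and
   compounds with [d1] on the product. Writing [chat1 i.-1] as exact value plus error splits off
   [alpha i * e1 i.-1]. *)
have -> : e2 i = e2 i.-1 - alpha i * e1 i.-1
    + (chat2 i.-1 * d2 - beta i ^+ 2 * d3 - chat2 i * d4)
    - alpha i * chat1 i.-1 * ((1 + d1) * (1 + d2) - 1).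
  by rewrite /e2 /e1 /coef_err hT char_coef2_recr //; lra.
apply: le_trans (ler_normB _ _) _; apply: lerD; last first.
  exact/prod_bound/gamma2_bound.
apply: le_trans (ler_normD _ _) _; apply: lerD; first exact: ler_normB.
rewrite !mulrDr.
apply: le_trans (ler_normB _ _) _; apply: lerD; last exact: prod_bound.
by apply: le_trans (ler_normB _ _) _; apply: lerD; exact: prod_bound.
Qed.
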